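(* Let $0<p<1$, let $\{X_n,\ n\ge1\}$ be the steps of the elephant random walk that remembers only the most recent step, with $P(X_1=1)=p=1-P(X_1=-1)$, and let $S_n=\sum_{k=1}^n X_k$. Then $\dfrac{S_n}{n}\to0$ almost surely as $n\to\infty$.
   Context: Elephant random walk remembering only the most recent step: for every $n\ge1$, $X_{n+1}=X_n$ with probability $p$ and $X_{n+1}=-X_n$ with probability $1-p$, i.e. $X_{n+1}=\varepsilon_{n+1}X_n$ where $\varepsilon_2,\varepsilon_3,\dots$ are i.i.d. with $P(\varepsilon_i=1)=p=1-P(\varepsilon_i=-1)$ and independent of $X_1$. *)

(* Defs.v *)
From HB Require Import structures.
From mathcomp Require Import all_boot all_order all_algebra finmap.
From mathcomp Require Import all_classical all_reals all_analysis.

Set Implicit Arguments.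
Unset Strict Implicit.
Unset Printing Implicit Defensive.

Import Order.TTheory GRing.Theory Num.Theory.
Import numFieldNormedType.Exports.

Local Open Scope classical_set_scope.
Local Open Scope ring_scope.

Definition mutually_independent (d : measure_display) (T : measurableType d)
    (R : realType) (P : probability T R) (D : set nat)
    (Y : nat -> {RV P >-> R}) : Prop :=
  forall (J : {fset nat}) (B : nat -> set R),
    [set` J] `<=` D -> (forall i, i \in J -> measurable (B i)) ->
    P (\bigcap_(i in [set` J]) (Y i @^-1` B i)) =
    (\prod_(i <- J) P (Y i @^-1` B i))%E.

Definition sigma_family (d : measure_display) (T : measurableType d)
    (R : realType) (P : probability T R) (D : set nat)
    (Y : nat -> {RV P >-> R}) : set (set T) :=
  <<s \bigcup_(i in D) preimage_set_system setT (Y i) measurable >>.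

Definition independent_of_family (d : measure_display) (T : measurableType d)
    (R : realType) (P : probability T R) (Z : {RV P >-> R}) (D : set nat)
    (Y : nat -> {RV P >-> R}) : Prop :=
  forall (B : set R) (C : set T), measurable B -> sigma_family D Y C ->
    P ((Z @^-1` B) `&` C) = (P (Z @^-1` B) * P C)%E.

(* Sequences are indexed from 1 (steps [X]) and from 2 (signs [eps]); the values
   [X 0], [eps 0] and [eps 1] are unconstrained and never used.  The [eps n] are
   identically distributed because their two atoms carry all the mass. *)
Record erw_recent_step (d : measure_display) (T : measurableType d)
    (R : realType) (P : probability T R) (p : R)
    (X eps : nat -> {RV P >-> R}) : Prop := ERWRecentStep {
  erw_eps_pos : forall n, (2 <= n)%N -> P [set w | eps n w = 1] = p%:E;
  erw_eps_neg : forall n, (2 <= n)%N -> P [set w | eps n w = -1] = (1 - p)%:E;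
  erw_eps_indep : mutually_independent [set n | (2 <= n)%N] eps;
  erw_first_indep : independent_of_family (X 1%N) [set n | (2 <= n)%N] eps;
  erw_step : forall n, (1 <= n)%N -> forall w, X n.+1 w = eps n.+1 w * X n w
}.

Definition erw_position (d : measure_display) (T : measurableType d)
    (R : realType) (P : probability T R) (X : nat -> {RV P >-> R})
    (n : nat) (w : T) : R :=
  \sum_(1 <= k < n.+1) X k w.

(* Main.v *)
(** Almost surely every [eps_i] is +-1, so [S_n = X_1 W_n] where [W_n] sums the
    partial products of the independent signs [e_i = 2 1_{eps_i = 1} - 1].  A
    product of two partial products is the product of the signs in between, of
    mean [r ^ (distance)] with [r = 2 p - 1]; as [|r| < 1], the covariances are
    summable and [E W_n^2 <= C n].  Hence [(W_(n^2) / n^2)^2] has a summable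
    expectation, which gives convergence along the squares, and bounded
    increments fill the gaps. *)

Require Import Defs.
From HB Require Import structures.
From mathcomp Require Import all_boot all_order all_algebra finmap.
From mathcomp Require Import all_classical all_reals all_analysis.
From mathcomp Require Import measurable_realfun ring lra.

Set Implicit Arguments.
Unset Strict Implicit.
Unset Printing Implicit Defensive.

Import Order.TTheory GRing.Theory Num.Theory.
Import numFieldNormedType.Exports.
Import HBSimple.

Local Open Scope classical_set_scope.
Local Open Scope ring_scope.

(** * Convergence criteria: square times, and summable expectations *)

(** Between [n ^ 2] and the next square, [t] moves by at most [2 n], which is negligible against
    [n ^ 2]. *)
Lemma cvg_of_square_times (R : realType) (t : nat -> R) :
  (forall n, `|t n.+1 - t n| <= 1) ->
  ((t (n.+1 ^ 2)%N / (n.+1 ^ 2)%:R) ^+ 2) @[n --> \oo] --> (0 : R) ->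
  (t n / n%:R) @[n --> \oo] --> (0 : R).
Proof.
move=> lip /cvgrPdist_lt sq0.
have lipD m k : `|t (m + k)%N - t m| <= k%:R.
  elim: k => [|k IH]; first by rewrite addn0 subrr normr0.
  rewrite addnS -natr1.
  have -> : t (m + k).+1 - t m =
      (t (m + k)%N - t m) + (t (m + k).+1 - t (m + k)%N) by ring.
  by rewrite (le_trans (ler_normD _ _))// lerD.
apply/cvgrPdist_lt => e e0.
have e20 : 0 < e / 2 by rewrite divr_gt0.
(* The budget [e] is halved. [N] handles the value at the square time, with threshold [(e / 2) ^ 2]
   since that quotient is squared. [M] gives [1 / (n + 1) < e / 4], so the gap [2 (n + 1)] is at
   most [e / 2] times [(n + 1) ^ 2]. *)
have [N _ HN] := sq0 _ (exprn_gt0 2 e20).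
have [M _ HM] := near_infty_natSinv_lt (PosNum (divr_gt0 e0 (ltr0n R 4))).
pose n0 := (maxn N M).+1.
exists (n0 ^ 2)%N => //= m mn0.
have [n /andP[n2m mn2]] : exists n, ((n ^ 2 <= m) && (m < n.+1 ^ 2))%N.
  elim: m {mn0} => [|m [n /andP[n2m mn2]]]; first by exists 0%N.
  have [|lt] := leqP (n.+1 ^ 2)%N m.+1; last first.
    by exists n; rewrite lt (leq_trans n2m).
  move=> le; exists n.+1; rewrite le/= (leq_ltn_trans mn2)// ltn_sqr//.
have n0n : (n0 <= n)%N by rewrite -ltnS -ltn_sqr (leq_ltn_trans mn0).
case: n n2m mn2 n0n => // n n2m mn2; rewrite /n0 ltnS geq_max => /andP[Nn Mn].
have := HN _ Nn; rewrite sub0r normrN normrX ltr_pXn2r ?nnegrE ?(ltW e20)//.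
have := HM _ Mn; rewrite /= => Hn.
rewrite normrM normfV normr_nat ltr_pdivrMr ?ltr0n// => Ht.
have m0 : (0 < m)%N by rewrite (leq_trans _ n2m).
rewrite sub0r normrN normrM normfV normr_nat ltr_pdivrMr ?ltr0n//.
have := lipD (n.+1 ^ 2)%N (m - n.+1 ^ 2)%N; rewrite subnKC// => Hd.
have Hk : (m - n.+1 ^ 2)%:R <= 2 * n.+1%:R :> R.
  rewrite -natrM ler_nat leq_subLR -ltnS (leq_trans mn2)//.
  by rewrite -[in leqLHS]addn1 sqrnD muln1 exp1n addn1 addSn.
have Hm : (n.+1 ^ 2)%:R <= m%:R :> R by rewrite ler_nat.
have n1 : 0 < n.+1%:R :> R by rewrite ltr0n.
have H2 : 2 * n.+1%:R <= e / 2 * (n.+1 ^ 2)%:R.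
  move: Hn; rewrite -[_^-1]div1r ltr_pdivrMr// => Hn.
  by rewrite natrX expr2 mulrA ler_pM2r//; lra.
have Hem : e * (n.+1 ^ 2)%:R <= e * m%:R by rewrite ler_pM2l.
have := ler_normD (t m - t (n.+1 ^ 2)%N) (t (n.+1 ^ 2)%N); rewrite subrK.
lra.
Qed.

(** Sum and integral may be exchanged by nonnegativity, so the series of the [f n] is integrable,
    hence finite almost everywhere, and its terms tend to 0. *)
Lemma ae_cvg0_of_summable_integral d (T : measurableType d) (R : realType)
    (mu : {measure set T -> \bar R}) (f : nat -> T -> R) :
  (forall n, measurable_fun setT (f n)) -> (forall n w, 0 <= f n w) ->
  (\sum_(n <oo) \int[mu]_w (f n w)%:E < +oo)%E ->
  {ae mu, forall w, f n w @[n --> \oo] --> (0 : R)}.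
Proof.
move=> mf f0 foo.
have mF n : measurable_fun setT (EFin \o f n).
  exact/measurable_EFinP.
pose g w := (\sum_(n <oo) (f n w)%:E)%E.
have g0 w : (0 <= g w)%E.
  by apply: nneseries_ge0 => n _ _; rewrite lee_fin.
have ig : mu.-integrable setT g.
  apply/integrableP; split.
    by apply: ge0_emeasurable_sum => [n w _ _|n _]; [rewrite lee_fin|exact: mF].
  under eq_integral do rewrite gee0_abs//.
  by rewrite integral_nneseries// => n w _; rewrite lee_fin.
apply: filterS (integrable_ae measurableT ig) => w /(_ I) gfin.
have : (\sum_(N <= n <oo) (f n w)%:E @[N --> \oo] --> 0)%E.
  apply: nneseries_tail_cvg => [|k _]; last by rewrite lee_fin.
  by rewrite ltey_eq gfin.
move=> tail.
(* The term of index [n] lies between 0 and the tail of the series from [n] on. *)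
have : ((f n w)%:E @[n --> \oo] --> 0%E).
  apply: squeeze_cvge tail; last exact: cvg_cst.
  near=> n; rewrite lee_fin f0/=.
  rewrite (nneseries_split _ 1)//; last by move=> k _; rewrite lee_fin.
  rewrite addn1 big_nat1 leeDl// nneseries_ge0// => k _ _.
  by rewrite lee_fin.
by move/fine_cvgP => [].
Unshelve. all: by end_near. Qed.

Lemma nneseries_inv_sqr_lty (R : realType) (f : nat -> \bar R) (C : R) :
  (forall n, 0 <= f n)%E -> (forall n, f n <= (C / (n.+1 ^ 2)%:R)%:E)%E ->
  (\sum_(n <oo) f n < +oo)%E.
Proof.
move=> f0 fC.
have C0 : 0 <= C.
  by have := le_trans (f0 0%N) (fC 0%N); rewrite exp1n divr1 lee_fin.
apply: (@le_lt_trans _ _ (C * 2)%:E); last exact: ltry.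
apply: lime_le; first exact: is_cvg_nneseries.
apply: nearW => N.
apply: (@le_trans _ _ (\sum_(0 <= n < N) (C / (n.+1 ^ 2)%:R))%:E).
  by rewrite -sumEFin; apply: lee_sum => n _; exact: fC.
rewrite lee_fin -mulr_sumr ler_wpM2l//.
case: N => [|N]; first by rewrite big_geq.
(* Subtracting [1 / (N + 1)] lets the induction close, by comparison with a telescoping sum. *)
apply: (@le_trans _ _ (2 - (N.+1%:R)^-1)).
  2: by rewrite lerBlDr lerDl invr_ge0.
elim: N => [|N IH]; first by rewrite big_nat1 exp1n invr1; lra.
rewrite big_nat_recr//=; apply: le_trans (lerD IH (lexx _)) _.
have n0 : 0 < N.+1%:R :> R by rewrite ltr0n.
rewrite natrX -(natr1 N.+1); set x := N.+1%:R in n0 *.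
rewrite -subr_ge0.
have -> : 2 - (x + 1)^-1 - (2 - x^-1 + ((x + 1) ^+ 2)^-1) =
   (x * (x + 1) ^+ 2)^-1.
  by field; rewrite ?gt_eqF//; lra.
by rewrite invr_ge0 mulr_ge0 ?sqr_ge0// ltW.
Qed.

(** * Expectation of products of independent signs *)

Section simple_expectation.
Context d (T : measurableType d) (R : realType) (P : probability T R).

Lemma integrable_sfun (f : {sfun T >-> R}) : P.-integrable setT (EFin \o f).
Proof.
apply: measurable_bounded_integrable => //.
- by rewrite (le_lt_trans (probability_le1 _ _))// ltry.
- have [M [Mreal HM]] := simple_bounded f.
  by exists M; split => // x Mx w _; exact: HM.
Qed.

(** Simple functions form a ring and are all integrable, so expectation is additive without side
    conditions and [ring] and the [raddf] lemmas apply. *)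
Definition expect (f : {sfun T >-> R}) : R := \int[P]_w f w.

Lemma expect_zmod_morphism : zmod_morphism expect.
Proof. by move=> f g; rewrite /expect RintegralB//; exact: integrable_sfun. Qed.

HB.instance Definition _ :=
  GRing.isZmodMorphism.Build {sfun T >-> R} R expect expect_zmod_morphism.

Lemma prod_indic_sfun (D : nat -> set T) (mD : forall i, measurable (D i))
    (s : seq nat) (w : T) :
  (\prod_(i <- s) indic_sfun _ (mD i) : {sfun T >-> R}) w =
  \1_(\bigcap_(i in [set` s]) D i) w.
Proof.
rewrite bigcap_seq; elim: s => [|i s IH]; first by rewrite !big_nil indicT.
by rewrite !big_cons indicI /= -IH.
Qed.

(* The indicator factors are carried along so that the induction, which trades
   one sign [2 1_D - 1] for an indicator, closes. *)
Lemma expect_prod_signs (D : nat -> set T) (mD : forall i, measurable (D i))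
    (p : R) (J K : seq nat) :
  (forall s, uniq s -> P (\bigcap_(i in [set` s]) D i) = (p ^+ size s)%:E) ->
  uniq (J ++ K) ->
  expect (\prod_(i <- J) (indic_sfun _ (mD i) *+ 2 - 1) *
          \prod_(i <- K) indic_sfun _ (mD i)) =
  (p *+ 2 - 1) ^+ size J * p ^+ size K.
Proof.
move=> indep; elim: J K => [|i J IH] K.
  move=> uK; rewrite big_nil !mul1r /expect /Rintegral.
  under eq_integral do rewrite prod_indic_sfun.
  have mK : measurable (\bigcap_(i in [set` K]) D i).
    exact: bigcap_measurableType.
  rewrite integral_indic ?setIT//; exact: (congr1 fine (indep _ uK)).
move=> /= /andP[iJK uJK]; rewrite big_cons.
set F := \big[_/_]_(j <- J) _; set G := \big[_/_]_(j <- K) _.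
have -> : (indic_sfun _ (mD i) *+ 2 - 1) * F * G =
    (F * \prod_(j <- i :: K) indic_sfun _ (mD j)) *+ 2 - F * G.
  by rewrite big_cons -/G; ring.
have uJiK : uniq (J ++ i :: K) by rewrite (uniq_catCA J [:: i] K)/= iJK.
rewrite raddfB raddfMn /= !IH//= !exprS; ring.
Qed.

End simple_expectation.

(** * The walk built from partial products of signs *)

Section product_walk.
Context d (T : measurableType d) (R : realType) (P : probability T R).
Context (D : nat -> set T) (mD : forall i, measurable (D i)) (p : R).
Context (p01 : 0 < p < 1).
Context (indep : forall s, uniq s ->
  P (\bigcap_(i in [set` s]) D i) = (p ^+ size s)%:E).

(** Built from an event, a sign is +-1 at every point and not just almost surely, so the identities
    below hold pointwise. *)
Definition sign i : {sfun T >-> R} := indic_sfun _ (mD i) *+ 2 - 1.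
Definition step n : {sfun T >-> R} := \prod_(0 <= i < n) sign i.
Definition walk n : {sfun T >-> R} := \sum_(0 <= k < n) step k.

(** [r] is the mean of a sign; [c], the sum of the geometric series in [|r|], will bound the sums of
    covariances. *)
Let r : R := p *+ 2 - 1.
Let c : R := (1 - `|r|)^-1.

Let r_lt1 : `|r| < 1.
Proof. by case/andP: p01 => p0 p1; rewrite /r ltr_norml; lra. Qed.

Lemma signE i w : sign i w = (-1) ^+ (w \notin D i).
Proof.
rewrite /sign [LHS](_ : _ = \1_(D i) w *+ 2 - 1)//.
by rewrite indicE; case: (w \in D i) => /=; lra.
Qed.

Lemma sign_sqr i : sign i * sign i = 1.
Proof.
apply/sfuneqP => w.
by rewrite -[LHS]/(sign i w * sign i w) signE -expr2 sqrr_sign.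
Qed.

(** The first [k] signs occur in both products and square to 1. *)
Lemma step_mul k n : (k <= n)%N -> step k * step n = \prod_(k <= i < n) sign i.
Proof.
move=> kn; rewrite /step (big_cat_nat (leq0n k) kn)/= mulrA -big_split/=.
by rewrite big1 ?mul1r// => i _; exact: sign_sqr.
Qed.

Lemma expect_step_mul k n : (k <= n)%N ->
  expect P (step k * step n) = r ^+ (n - k).
Proof.
move=> kn; rewrite step_mul//.
have := @expect_prod_signs _ _ _ P D mD p (index_iota k n) [::] indep.
rewrite cats0 iota_uniq big_nil !mulr1 size_iota => -> //.
Qed.

Lemma normr_step n w : `|step n w| = 1.
Proof.
have : step n w * step n w = 1.
  by rewrite -[LHS]/((step n * step n) w) step_mul// big_geq.
by move/eqP; rewrite -expr2 sqrf_eq1 => /orP[] /eqP ->; rewrite ?normrN normr1.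
Qed.

Lemma normr_expect_walk_step n : `|expect P (walk n * step n)| <= c.
Proof.
have c0 : 0 < c by rewrite invr_gt0 subr_gt0.
have -> : expect P (walk n * step n) = \sum_(0 <= k < n) r ^+ (n - k).
  rewrite mulr_suml raddf_sum; apply: eq_big_nat => k /andP[_ kn].
  by rewrite /= expect_step_mul// ltnW.
elim: n => [|n IH]; first by rewrite big_geq// normr0 ltW.
rewrite big_nat_recr//= subSnn expr1.
have -> : \sum_(0 <= k < n) r ^+ (n.+1 - k) =
    r * \sum_(0 <= k < n) r ^+ (n - k).
  rewrite mulr_sumr; apply: eq_big_nat => k /andP[_ kn].
  by rewrite subSn ?exprS// ltnW.
(* The sums obey [s (n + 1) = r (s n + 1)], and [|r| (c + 1) = c - 1 + |r| <= c]. *)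
rewrite -[X in _ + X]mulr1 -mulrDr normrM.
apply: (@le_trans _ _ (`|r| * (c + 1))).
  by rewrite ler_wpM2l// (le_trans (ler_normD _ _))// normr1 lerD2r.
have : c * (1 - `|r|) = 1 by rewrite mulVf// gt_eqF// subr_gt0.
by have := r_lt1; lra.
Qed.

(** Each new step adds 1 plus twice its covariance with the walk so far, which is at most [c]. *)
Lemma expect_walk_sqr n : expect P (walk n * walk n) <= (2 * c + 1) * n%:R.
Proof.
elim: n => [|n IH]; first by rewrite /walk big_geq// mul0r raddf0 mulr0.
have -> : walk n.+1 = walk n + step n by rewrite /walk big_nat_recr.
have -> : (walk n + step n) * (walk n + step n) =
    walk n * walk n + (walk n * step n) *+ 2 + step n * step n by ring.
rewrite 2!raddfD raddfMn/= expect_step_mul// subnn expr0.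
have := ler_norm (expect P (walk n * step n)).
have := normr_expect_walk_step n.
rewrite -natr1; lra.
Qed.

(** With [N = (n + 1) ^ 2], the second moment of [walk N / N] is at most [C / N], which is summable
    in [n]; along all times the bound [C / n] would not be. *)
Lemma walk_slln : {ae P, forall w, (walk n w / n%:R) @[n --> \oo] --> (0 : R)}.
Proof.
pose C : R := 2 * c + 1.
pose f n w : R := (walk (n.+1 ^ 2)%N w / (n.+1 ^ 2)%:R) ^+ 2.
have fE n : f n = (fun w => (walk (n.+1 ^ 2)%N * walk (n.+1 ^ 2)%N) w *
    ((n.+1 ^ 2)%:R ^+ 2)^-1).
  by apply/funext => w; rewrite /f expr_div_n [in LHS]expr2.
have f0 n w : 0 <= f n w by exact: sqr_ge0.
have : {ae P, forall w, f n w @[n --> \oo] --> (0 : R)}.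
  apply: ae_cvg0_of_summable_integral => // [n|].
    by rewrite fE; apply: measurable_funM => //; exact: measurable_cst.
  apply: (@nneseries_inv_sqr_lty _ _ C) => n.
    by apply: integral_ge0 => w _; rewrite lee_fin.
  have iw := integrable_sfun P (walk (n.+1 ^ 2)%N * walk (n.+1 ^ 2)%N).
  have N0 : 0 < (n.+1 ^ 2)%:R :> R by rewrite ltr0n.
  have -> : (\int[P]_w (f n w)%:E =
      (expect P (walk (n.+1 ^ 2)%N * walk (n.+1 ^ 2)%N) *
       ((n.+1 ^ 2)%:R ^+ 2)^-1)%:E)%E.
    under eq_integral do rewrite fE EFinM.
    rewrite integralZr// EFinM /expect /Rintegral fineK//.
    exact: integrable_fin_num.
  rewrite lee_fin ler_pdivrMr ?exprn_gt0// (le_trans (expect_walk_sqr _))//.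
  by rewrite expr2 mulrA divfK// gt_eqF.
apply: filterS => w fw; apply: cvg_of_square_times => // n.
by rewrite /walk big_nat_recr//= addrAC subrr add0r normr_step.
Qed.

End product_walk.

(** * Transfer to the elephant random walk *)

Theorem theorem8p2 (R : realType) (d : measure_display) (T : measurableType d)
    (P : probability T R) (p : R) (X eps : nat -> {RV P >-> R})
    (hp0 : 0 < p) (hp1 : p < 1)
    (hX : erw_recent_step p X eps)
    (hX1pos : P [set w | X 1%N w = 1] = p%:E)
    (hX1neg : P [set w | X 1%N w = -1] = (1 - p)%:E) :
  {ae P, forall w, (erw_position X n w / n%:R) @[n --> \oo] --> (0 : R)}.
Proof.
have [eps_pos eps_neg eps_indep _ X_step] := hX.
pose B : set R := [set 1].
(* The shift by 2 makes [eps 2], the first sign, correspond to index 0. *)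
pose D i := eps i.+2 @^-1` B.
have mD i : measurable (D i).
  by apply: measurable_funPTI; exact: measurable_set1.
have indepD s : uniq s -> P (\bigcap_(i in [set` s]) D i) = (p ^+ size s)%:E.
  move=> us.
  pose J : {fset nat} := [fset i in [seq i.+2 | i <- s]]%fset.
  have := eps_indep J (fun=> B).
  have -> : \bigcap_(i in [set` J]) (eps i @^-1` B) =
      \bigcap_(i in [set` s]) D i.
    apply/seteqP; split => w H i /=.
      by move=> iS; apply: H; rewrite /= inE; apply: map_f.
    by rewrite inE => /mapP[j js ->]; exact: H.
  move=> ->//; first last.
  - by move=> i _; exact: measurable_set1.
  - by move=> i; rewrite /= inE => /mapP[j _ ->].
  have -> : (\prod_(i <- J) P (eps i @^-1` B) =
      \prod_(i <- [seq i.+2 | i <- s]) P (eps i @^-1` B))%E.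
    apply: perm_big; apply: uniq_perm; rewrite ?fset_uniq//.
      by rewrite map_inj_uniq// => i j [].
    by move=> i; rewrite inE.
  rewrite big_map; elim: s {us J} => [|i s IH]; first by rewrite big_nil.
  by rewrite big_cons IH eps_pos// exprS EFinM.
(* The two disjoint atoms have total mass [p + (1 - p) = 1], so their complement is null. *)
have two_atoms (Y : {RV P >-> R}) : P [set w | Y w = 1] = p%:E ->
    P [set w | Y w = -1] = (1 - p)%:E -> {ae P, forall w, Y w = 1 \/ Y w = -1}.
  move=> Y1 YN1.
  have mY (a : R) : measurable [set w | Y w = a].
    rewrite -[X in measurable X]/(Y @^-1` [set a]).
    by apply: measurable_funPTI; exact: measurable_set1.
  have mU := measurableU _ _ (mY 1) (mY (-1)).
  exists (~` ([set w | Y w = 1] `|` [set w | Y w = -1])); split => //.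
  - exact: measurableC.
  - rewrite probability_setC// measureU//; last first.
      by apply/seteqP; split => w //= [-> /eqP]; rewrite -subr_eq0 opprK; lra.
    rewrite [X in (_ - (X + _))%E]Y1 [X in (_ - (_ + X))%E]YN1 -EFinD.
    by rewrite addrC subrK subrr.
have p01 : 0 < p < 1 by rewrite hp0.
have atoms_eps : {ae P, forall w, forall n, eps n.+2 w = 1 \/ eps n.+2 w = -1}.
  by apply: ae_foralln => n; apply: two_atoms; [exact: eps_pos|exact: eps_neg].
apply: filterS2 (walk_slln mD p01 indepD) atoms_eps => w cvgW atomsW.
(* Unrolling the recursion leaves [X 1] as a common factor; [step 0] is the empty product. *)
have XE k : X k.+1 w = X 1%N w * step R mD k w.
  elim: k => [|k IH]; first by rewrite /step big_geq// mulr1.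
  rewrite X_step// IH mulrCA; congr (_ * _).
  have -> : step R mD k.+1 = step R mD k * sign R mD k.
    by rewrite /step big_nat_recr.
  rewrite mulrC -[RHS]/(step R mD k w * sign R mD k w); congr (_ * _).
  rewrite signE; case: (atomsW k) => e.
    by rewrite e mem_set.
  rewrite e memNset ?expr1// /D /= e => /eqP; rewrite -subr_eq0; lra.
have SE n : erw_position X n w / n%:R = X 1%N w * (walk R mD n w / n%:R).
  rewrite mulrA; congr (_ / _).
  rewrite /erw_position big_add1/= /walk sfun_sum mulr_sumr.
  by apply: eq_bigr => k _; exact: XE.
under eq_fun do rewrite SE.
(* For fixed [w] the first step is a constant factor, so the limit is [X 1 w * 0]. *)
have := cvgM (cvg_cst (X 1%N w : R)) cvgW.
by rewrite mulr0; apply.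
Qed.
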